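(* Let $\Bbbk$ be an algebraically closed field with $\operatorname{char}(\Bbbk)=0$ and suppose $\gamma\in\Bbbk^\times$. Let $\mathfrak L(\gamma)\subset\mathbb P^5$ be the line scheme of the algebra $\mathcal A(\gamma)$, whose points parametrize lines in $\mathbb P(V^* )=\mathbb P^3$, and let $\mathcal Z_\gamma\subset\mathbb P(V^* )$ be the scheme of zeros of $\rho_1,\rho_2,\rho_3$ (all defined in the context). (a) For any $j\in\{1,\dots,4\}$, the point $e_j$ lies on infinitely many lines that are parametrized by $\mathfrak L(\gamma)$. (b) Each point of $\mathcal Z_\gamma$ lies on exactly six distinct lines of those parametrized by $\mathfrak L(\gamma)$.
   Context: For $\gamma\in\Bbbk^\times$, $\mathcal A(\gamma)$ is the $\Bbbk$-algebra on generators $x_1,\dots,x_4$ with defining relations $x_4x_1=ix_1x_4$, $x_3^2=x_1^2$, $x_3x_1=x_1x_3-x_2^2$, $x_3x_2=ix_2x_3$, $x_4^2=x_2^2$, $x_4x_2=x_2x_4-\gamma x_1^2$, where $i\in\Bbbk$, $i^2=-1$. Let $V=\sum_{k=1}^4\Bbbk x_k$ and identify $\mathbb P(V^* )$ with $\mathbb P^3$, with homogeneous coordinates $x_1,\dots,x_4$. Write $e_1=(1,0,0,0)$, $e_2=(0,1,0,0)$, $e_3=(0,0,1,0)$, $e_4=(0,0,0,1)$. $\mathcal Z_\gamma$ is the scheme of zeros in $\mathbb P(V^* )$, in the affine chart $x_1=1$, of \[ \rho_1=x_4^8-4x_4^4+\gamma^2,\quad \rho_2=x_3^2-ix_3x_4^2-1,\quad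 \rho_3=\gamma x_2-2ix_4^3+x_3x_4^5 ; \] its points have the form $(1,\alpha_2,\alpha_3,\alpha_4)$. The homogeneous coordinates on $\mathbb P^5$ are the Plücker coordinates $M_{12},M_{13},M_{14},M_{23},M_{24},M_{34}$, and $P=M_{12}M_{34}-M_{13}M_{24}+M_{14}M_{23}$ is the Plücker polynomial. The line in $\mathbb P(V^* )=\mathbb P^3$ through distinct points $(a_1,\dots,a_4)$ and $(b_1,\dots,b_4)$ corresponds to the point of the zero locus of $P$ in $\mathbb P^5$ with $M_{jk}=a_jb_k-a_kb_j$; the zero locus of $P$ parametrizes all lines in $\mathbb P^3$. The lines parametrized by $\mathfrak L(\gamma)$ are those corresponding to the closed points of $\mathfrak L(\gamma)$. Line scheme as a closed subscheme of $\mathbb P^5$: let \[ \mathcal M(\gamma)=\begin{bmatrix} 0&u_1&0&0&0&v_1&0&0\\ u_2&0&0&0&v_2&0&0&0\\ 0&0&0&u_3&0&0&0&v_3\\ 0&0&u_4&0&0&0&v_4&0\\ u_3&0&u_1&0&v_3&0&v_1&0\\ 0&u_4&0&u_2&0&v_4&0&v_2\\ -u_4&0&0&iu_1&-v_4&0&0&iv_1\\ 0&-u_3&iu_2&0&0&-v_3&iv_2&0\\ u_1&0&u_3&\gamma u_2&v_1&0&v_3&\gamma v_2\\ 0&u_2&u_1&u_4&0&v_2&v_1&v_4 \end{bmatrix}. \] Each of its forty-five $8\times 8$ minors can be written as a homogeneous quartic polynomial in the quantities $N_{ij}=u_iv_j-u_jv_i$, $1\le i<j\le 4$ (uniquely modulo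 the Plücker relation $N_{12}N_{34}-N_{13}N_{24}+N_{14}N_{23}=0$). Substituting $N_{12}\mapsto M_{34}$, $N_{13}\mapsto -M_{24}$, $N_{14}\mapsto M_{23}$, $N_{23}\mapsto M_{14}$, $N_{24}\mapsto -M_{13}$, $N_{34}\mapsto M_{12}$ gives forty-five quartic polynomials in the $M_{ij}$. The line scheme $\mathfrak L(\gamma)$ of $\mathcal A(\gamma)$ is the closed subscheme of $\mathbb P^5$ defined by these forty-five polynomials together with $P$. *)

(* Defs.v *)
From HB Require Import structures.
From mathcomp Require Import all_boot all_order all_algebra.
From mathcomp Require Import perm mpoly.
From mathcomp Require Import classical_sets functions cardinality.

Set Implicit Arguments.
Unset Strict Implicit.
Unset Printing Implicit Defensive.

Import GRing.Theory.
Local Open Scope ring_scope.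
Local Open Scope classical_set_scope.

(* All indices are shifted by one: x_1, ..., x_4 have indices 0, ..., 3 in     *)
(* 'I_4, and the pairs 12, 13, 14, 23, 24, 34 have indices 0, ..., 5 in 'I_6.  *)

Definition plucker (R : comNzRingType) (a b : 'I_4 -> R) : 6.-tuple R :=
  let m (s t : 'I_4) := a s * b t - a t * b s in
  [tuple m 0 1; m 0 2; m 0 3; m 1 2; m 1 3; m 2 3].

(* The first four columns of M(gamma) for w = u, the last four for w = v. *)
Definition half_mx (R : comNzRingType) (i gamma : R) (w : 'I_4 -> R) :
    'M[R]_(10, 4) :=
  let w1 := w 0 in let w2 := w 1 in let w3 := w 2 in let w4 := w 3 in
  let rows :=
    [:: [:: 0  ; w1 ; 0     ; 0         ];
        [:: w2 ; 0  ; 0     ; 0         ];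
        [:: 0  ; 0  ; 0     ; w3        ];
        [:: 0  ; 0  ; w4    ; 0         ];
        [:: w3 ; 0  ; w1    ; 0         ];
        [:: 0  ; w4 ; 0     ; w2        ];
        [:: -w4; 0  ; 0     ; i * w1    ];
        [:: 0  ; -w3; i * w2; 0         ];
        [:: w1 ; 0  ; w3    ; gamma * w2];
        [:: 0  ; w2 ; w1    ; w4        ]] in
  \matrix_(a, b) nth 0 (nth [::] rows a) b.

Section LineScheme.
Variable R : comNzRingType.

Definition u_var (j : 'I_4) : {mpoly R[4 + 4]} := 'X_(lshift 4 j).
Definition v_var (j : 'I_4) : {mpoly R[4 + 4]} := 'X_(rshift 4 j).

Definition line_mx (i gamma : R) : 'M[{mpoly R[4 + 4]}]_(10, 4 + 4) :=
  row_mx (half_mx i%:MP gamma%:MP u_var) (half_mx i%:MP gamma%:MP v_var).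

(* q is a quartic form in the N_ij expressing the 8 x 8 minor of M(gamma) on   *)
(* the rows r; two such forms differ by a multiple of the Pluecker relation.   *)
Definition minor_form (i gamma : R) (r : 'I_8 -> 'I_10) (q : {mpoly R[6]}) :=
  q \is 4.-homog /\
  q \mPo plucker u_var v_var = \det (rowsub r (line_mx i gamma)).

(* The images of N_12, N_13, N_14, N_23, N_24, N_34. *)
Definition dual_coords : 6.-tuple {mpoly R[6]} :=
  [tuple 'X_5; - 'X_4; 'X_3; 'X_2; - 'X_1; 'X_0].

Definition plucker_poly : {mpoly R[6]} :=
  'X_0 * 'X_5 - 'X_1 * 'X_4 + 'X_2 * 'X_3.

(* Every choice of a form for each of the minors is included; modulo           *)
(* plucker_poly the choice is unique, so the ideal generated is the same.      *)
Definition line_scheme_eqs (i gamma : R) : set {mpoly R[6]} :=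
  [set p | p = plucker_poly \/
     exists (r : 'I_8 -> 'I_10) (q : {mpoly R[6]}),
       [/\ forall a b : 'I_8, (a < b)%N -> (r a < r b)%N,
           minor_form i gamma r q & p = q \mPo dual_coords]].

(* M represents a closed point (over an algebraically closed field) of the     *)
(* closed subscheme of the projective space defined by the forms in E.         *)
Definition closed_point n (E : set {mpoly R[n]}) (M : 'rV[R]_n) :=
  M != 0 /\ forall p, E p -> p.@[M 0] = 0.

End LineScheme.

(* A point of P^3 is the span of a nonzero row vector, and a line of P^3 is a  *)
(* vector subspace of dimension 2.                                             *)
Section Lines.
Variables (k : fieldType) (i gamma : k).

(* The dimension condition says that a and b are distinct points of P^3. *)
Definition parametrized_lines : set {vspace 'rV[k]_4} :=
  [set l | exists a b : 'rV[k]_4,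
     [/\ l = (<[a]> + <[b]>)%VS, \dim l = 2%N
       & closed_point (line_scheme_eqs i gamma)
           (\row_j tnth (plucker (a 0) (b 0)) j)]].

Definition lines_through (a : 'rV[k]_4) : set {vspace 'rV[k]_4} :=
  [set l | parametrized_lines l /\ a \in l].

Definition Zgamma : set 'rV[k]_4 :=
  [set a : 'rV[k]_4 |
     let x2 := a 0 1 in let x3 := a 0 2 in let x4 := a 0 3 in
     [/\ a 0 0 = 1,
         x4 ^+ 8 - 4 * x4 ^+ 4 + gamma ^+ 2 = 0,
         x3 ^+ 2 - i * x3 * x4 ^+ 2 - 1 = 0
       & gamma * x2 - 2 * i * x4 ^+ 3 + x3 * x4 ^+ 5 = 0]].

End Lines.

(* Every minor has a form as in minor_form, so line_scheme_eqs misses none:    *)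
(* the minor is sum_f D(f) prod_j u_(f j) v_(f (4 + j)), where D(f) changes    *)
(* sign when the values of f at j and 4 + j are exchanged.                     *)
Section MinorFormExists.
Variables (F : fieldType) (i gamma : F).

Lemma det_cols_expand (R : comNzRingType) m n (x : 'I_n -> 'I_m -> R)
    (B : 'I_m -> 'I_n -> 'I_n -> R) :
  \det (\matrix_(a, c) \sum_s x c s * B s a c) =
  \sum_(f : {ffun 'I_n -> 'I_m})
    (\prod_c x c (f c)) * \det (\matrix_(a, c) B (f c) a c).
Proof.
rewrite -[LHS]det_tr [LHS]/(determinant _).
under eq_bigr => s _.
  under eq_bigr => c _ do rewrite !mxE.
  rewrite bigA_distr_bigA mulr_sumr /=; over.
rewrite exchange_big; apply: eq_bigr => f _ /=.
rewrite -[in RHS]det_tr /determinant mulr_sumr.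
apply: eq_bigr => s _; rewrite big_split /= mulrCA; congr (_ * (_ * _)).
by apply: eq_bigr => c _; rewrite !mxE.
Qed.

Definition colpart (c : 'I_(4 + 4)) : 'I_4 :=
  match fintype.split c with inl j => j | inr j => j end.

Lemma colpart_l j : colpart (lshift 4 j) = j.
Proof. by rewrite /colpart (unsplitK (inl _ j)). Qed.

Lemma colpart_r j : colpart (rshift 4 j) = j.
Proof. by rewrite /colpart (unsplitK (inr _ j)). Qed.

Definition coef_mx (s : 'I_4) : 'M[F]_(10, 4) :=
  half_mx i gamma (fun t => (s == t)%:R).

Lemma half_mx_sum (w : 'I_4 -> {mpoly F[4 + 4]}) a b :
  half_mx i%:MP gamma%:MP w a b = \sum_s w s * (coef_mx s a b)%:MP.
Proof.
rewrite !big_ord_recr big_ord0 /= add0r !mxE.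
have -> : w (widen_ord (leqnSn 3) (widen_ord (leqnSn 2)
            (widen_ord (leqnSn 1) ord_max))) = w 0 by congr w; apply/val_inj.
have -> : w (widen_ord (leqnSn 3) (widen_ord (leqnSn 2) ord_max)) = w 1
  by congr w; apply/val_inj.
have -> : w (widen_ord (leqnSn 3) ord_max) = w 2 by congr w; apply/val_inj.
have -> : w ord_max = w 3 by congr w; apply/val_inj.
by case: a => [[|[|[|[|[|[|[|[|[|[|a]]]]]]]]]] lta] //=;
   case: b => [[|[|[|[|b]]]] ltb] //=;
   rewrite ?mulr1 ?mulr0 ?mpolyCN ?mpolyC1 ?mpolyC0 ?mulrN1 ?mulr0 ?mulr1
     ?oppr0 ?mpolyC0 ?mulr0 ?addr0 ?add0r //; rewrite mulrC.
Qed.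

Variable r : 'I_8 -> 'I_10.

Definition Dcoef (f : {ffun 'I_(4 + 4) -> 'I_4}) : F :=
  \det (\matrix_(a, c) coef_mx (f c) (r a) (colpart c)).

Definition swp (j : 'I_4) : {perm 'I_(4 + 4)} :=
  tperm (lshift 4 j) (rshift 4 j).

Definition act (j : 'I_4) (f : {ffun 'I_(4 + 4) -> 'I_4}) :
  {ffun 'I_(4 + 4) -> 'I_4} := [ffun c => f (swp j c)].

Lemma actK j : involutive (act j).
Proof. by move=> f; apply/ffunP => c; rewrite !ffunE tpermK. Qed.

Lemma colpart_swp j c : colpart (swp j c) = colpart c.
Proof. by rewrite /swp; case: tpermP => // ->; rewrite colpart_l colpart_r. Qed.

Lemma Dcoef_act j f : Dcoef (act j f) = - Dcoef f.
Proof.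
pose A := \matrix_(a, c) coef_mx (f c) (r a) (colpart c).
rewrite /Dcoef -/A -mulN1r.
have -> : (-1) = (-1) ^+ swp j :> F.
  by rewrite odd_tperm -val_eqE /= ltn_eqF // (leq_trans (ltn_ord j)) ?leq_addr.
have -> : \matrix_(a, c) coef_mx (act j f c) (r a) (colpart c)
          = col_perm (swp j) A.
  by apply/matrixP => a c; rewrite !mxE ffunE colpart_swp.
by rewrite col_permE tpermV det_mulmx det_perm mulrC.
Qed.

Let P := {mpoly F[4 + 4]}.

Definition wt (j : 'I_4) (f : {ffun 'I_(4 + 4) -> 'I_4}) : P :=
  u_var F (f (lshift 4 j)) * v_var F (f (rshift 4 j)).

Lemma det_line_mx :
  \det (rowsub r (line_mx i gamma)) =
  \sum_f (Dcoef f)%:MP * \prod_j wt j f :> P.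
Proof.
pose x (c : 'I_(4 + 4)) (s : 'I_4) : P := if fintype.split c is inl _ then u_var F s else v_var F s.
transitivity (\det (\matrix_(a < 8, c < 4 + 4)
    \sum_s x c s * (coef_mx s (r a) (colpart c))%:MP)).
  congr (\det _); apply/matrixP => a c; rewrite [in LHS]mxE [in RHS]mxE [in LHS]mxE.
  by rewrite /x /colpart; case: fintype.splitP => j _; rewrite half_mx_sum.
rewrite (det_cols_expand x (fun s a c => (coef_mx s (r a) (colpart c))%:MP)).
apply: eq_bigr => f _; rewrite mulrC; congr (_ * _).
  rewrite /Dcoef -det_map_mx; congr (\det _).
  by apply/matrixP => a c; rewrite !mxE.
rewrite big_split_ord /= -big_split /=; apply: eq_bigr => j _.
by rewrite /x (unsplitK (inl _ j)) (unsplitK (inr _ j)).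
Qed.

Lemma antisym_step j (G : {ffun 'I_(4 + 4) -> 'I_4} -> P) :
  (forall f, G (act j f) = G f) ->
  \sum_f (Dcoef f)%:MP * (G f * (wt j f - wt j (act j f))) =
  2 * \sum_f (Dcoef f)%:MP * (G f * wt j f).
Proof.
move=> hG.
under eq_bigr => f _ do rewrite !mulrBr.
rewrite sumrB [X in _ - X](reindex_inj (inv_inj (actK j))) /=.
under [X in _ - X]eq_bigr => f _ do rewrite actK hG Dcoef_act mpolyCN mulNr.
by rewrite sumrN opprK mulr_natl mulr2n.
Qed.

Lemma act_other j j' f : j != j' ->
  act j' f (lshift 4 j) = f (lshift 4 j) /\ act j' f (rshift 4 j) = f (rshift 4 j).
Proof.
move=> ne; have ne' : (val j' == val j) = false by rewrite eq_sym; apply/negbTE.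
have lt4 (a b : 'I_4) : (4 + b == a)%N = false.
  by rewrite gtn_eqF // (leq_trans (ltn_ord a)) ?leq_addr.
by rewrite !ffunE !tpermD // -val_eqE /= ?eqn_add2l ?ne' ?lt4 // eq_sym lt4.
Qed.

Definition Nform (s t : 'I_4) : {mpoly F[6]} :=
  let l (a b : nat) : 'I_6 :=
    inord (nth 0%N (nth [::] [:: [:: 0; 0; 1; 2]; [:: 0; 0; 3; 4];
                               [:: 0; 0; 0; 5]] a) b)%N in
  if (s < t)%N then 'X_(l s t) else if (t < s)%N then - 'X_(l t s) else 0.

Lemma Nform_comp s t :
  Nform s t \mPo plucker (u_var F) (v_var F) =
  u_var F s * v_var F t - u_var F t * v_var F s.
Proof.
have E (a b : 'I_4) : (val a = val b) -> a = b by exact: val_inj.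
rewrite /Nform; case: ltngtP => [lt_st|lt_ts|/E ->]; last first.
- by rewrite comp_mpoly0 subrr.
- rewrite comp_mpolyN comp_mpolyXU inordK; last first.
    by case: s lt_ts => [[|[|[|[]]]] ?] //; case: t => [[|[|[|[]]]] ?].
  rewrite -[RHS]opprB; congr (- _).
  case: s lt_ts => [[|[|[|[|]]]] hs] //; case: t => [[|[|[|[|]]]] ht] //= _;
  congr (u_var _ _ * v_var _ _ - u_var _ _ * v_var _ _); exact: val_inj.
rewrite comp_mpolyXU inordK; last first.
  by case: s lt_st => [[|[|[|[]]]] ?] //; case: t => [[|[|[|[]]]] ?].
case: s lt_st => [[|[|[|[|]]]] hs] //; case: t => [[|[|[|[|]]]] ht] //= _;
congr (u_var _ _ * v_var _ _ - u_var _ _ * v_var _ _); exact: val_inj.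
Qed.

Lemma Nform_homog s t : Nform s t \is 1.-homog.
Proof.
have homX l : ('X_l : {mpoly F[6]}) \is 1.-homog by rewrite dhomogX /= mdeg1.
by rewrite /Nform; case: ltngtP => _; rewrite ?rpredN ?rpred0 ?homX.
Qed.

Lemma minor_form_exists : (2 : F) != 0 -> exists q, minor_form i gamma r q.
Proof.
move=> nz2.
pose pf (f : {ffun 'I_(4 + 4) -> 'I_4}) (j : 'I_4) := Nform (f (lshift 4 j)) (f (rshift 4 j)).
exists ((16 : F)^-1 *: \sum_f Dcoef f *: \prod_j pf f j); split.
  rewrite rpredZ // rpred_sum // => f _; rewrite rpredZ //.
  rewrite !big_ord_recl big_ord0 mulr1.
  by do 3! [apply: (@dhomogM _ _ _ 1 _ _); first exact: Nform_homog];
     exact: Nform_homog.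
rewrite comp_mpolyZ (raddf_sum (comp_mpoly (plucker (u_var F) (v_var F)))) /=.
have pfE f j : pf f j \mPo plucker (u_var F) (v_var F) = wt j f - wt j (act j f).
  rewrite Nform_comp /wt !ffunE tpermL tpermR; congr (_ - _); exact: mulrC.
pose m j f := wt j f - wt j (act j f).
have mA j j' f : j != j' -> m j (act j' f) = m j f.
  move=> ne; rewrite /m /wt !ffunE -/(swp _) !tpermL !tpermR.
  by have [] := act_other f ne; rewrite !ffunE => -> ->.
have wA j j' f : j != j' -> wt j (act j' f) = wt j f.
  by move=> ne; rewrite /wt; have [-> ->] := act_other f ne.
pose mixed n (f : {ffun 'I_(4 + 4) -> 'I_4}) : P := \prod_j (if (val j < n)%N then wt j f else m j f).
have step (j : 'I_4) : \sum_f (Dcoef f)%:MP * mixed j f =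
                       2 * \sum_f (Dcoef f)%:MP * mixed j.+1 f.
  pose G f := \prod_(j' | j' != j) (if (val j' < j)%N then wt j' f else m j' f).
  have hG f : G (act j f) = G f.
    by apply: eq_bigr => j' ne; rewrite wA // mA.
  have -> : \sum_f (Dcoef f)%:MP * mixed j.+1 f =
            \sum_f (Dcoef f)%:MP * (G f * wt j f).
    apply: eq_bigr => f _; congr (_ * _); rewrite /mixed (bigD1 j) //= ltnSn.
    rewrite mulrC; congr (_ * _); apply: eq_bigr => j' ne.
    by rewrite ltnS leq_eqVlt val_eqE (negbTE ne).
  rewrite -antisym_step //; apply: eq_bigr => f _; congr (_ * _).
  by rewrite /mixed (bigD1 j) //= ltnn mulrC.
rewrite det_line_mx.
transitivity (16^-1 *: \sum_f (Dcoef f)%:MP * mixed 0%N f).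
  congr (_ *: _); apply: eq_bigr => f _.
  rewrite comp_mpolyZ rmorph_prod /= -mul_mpolyC.
  by congr (_ * _); apply: eq_bigr => j _; rewrite pfE.
rewrite (step 0) (step 1) (step 2) (step 3) !mulrA -!natrM.
rewrite -mul_mpolyC mulrA -mpolyC_nat -mpolyCM.
rewrite mulVf ?mpolyC1 ?mul1r; last first.
  by rewrite (_ : 16 = 2 ^+ 4) ?expf_neq0 // -natrX.
apply: eq_bigr => f _; congr (_ * _); apply: eq_bigr => j _.
by rewrite ltn_ord.
Qed.
End MinorFormExists.

(* Main.v *)
Require Import Defs.
From HB Require Import structures.
From mathcomp Require Import all_boot all_order all_algebra.
From mathcomp Require Import mpoly.
From mathcomp Require Import classical_sets functions cardinality.
From mathcomp Require Import ring.

Set Implicit Arguments.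
Unset Strict Implicit.
Unset Printing Implicit Defensive.

Import GRing.Theory.
Local Open Scope ring_scope.

(** A line of P^3 belongs to the line scheme exactly when some nonzero quadratic
relation of the algebra is a tensor u (x) p + v (x) q of rank at most two whose
left factors u, v are linear forms vanishing on the line.  Indeed the ten rows
of M(gamma) are the bilinear forms spanning the orthogonal of the six relations,
so a vector (p, q) killed by M(gamma)(u, v) is the same thing as a relation
u (x) p + v (x) q, and such a nonzero vector exists iff all 8 x 8 minors vanish.
Writing a relation as the 4 x 4 matrix of its coefficients ([relation_mx]), the
line through a and b is parametrized iff a Q = b Q = 0 for some nonzero relation
matrix Q.  The passage from the minors, which are forms in the Pluecker
coordinates, to this criterion uses the skew matrix of the dual coordinates of
the line: each of its rows vanishes on the line, and any two rows s, t for which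
the (s, t) entry is nonzero form a basis of the linear forms vanishing on the
line ([closed_point_line_schemeP], [parametrized_linesP]).

(a) For a = e_j the condition a Q = 0 makes one row of Q zero; requiring the
remaining 3 x 3 block to kill b as well cuts out a plane cubic in the
projection from e_j.  This cubic can be solved by one square root over each
nonzero value of a suitable affine coordinate, so it has infinitely many points.

(b) Let a = (1, x, y, z) be in Z_gamma.  Its equations give i y z^2 = y^2 - 1,
gamma x = i z^3 (1 + y^2) and x^2 = - y^2 z^2, and x, y, z, y^2 - 1 are nonzero.
The relations Q(l_1, ..., l_6) with a Q = 0 are then parametrized by the
(l_1, l_3, l_4, l_6) satisfying one linear equation, all four coefficients of
which are nonzero ([relation_through_pointP]).  As no coordinate of a is zero,
every second point on a line through a can be written (c_1 a_1, ..., c_4 a_4),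
with c_1 = 0 after subtracting a multiple of a.  In the four equations b Q = 0
the unknowns decouple completely:
l_3 (c_3 - c_1) = l_1 (c_4 - c_1) = l_4 (c_3 - c_2) = l_6 (c_4 - c_2) = 0
([rescale_relation]).  The linear equation forbids exactly one of l_1, l_3, l_4,
l_6 to be nonzero, so two of the four coordinate differences vanish, and each of
the six pairs of differences determines c up to scaling.  The six solutions are
the lines joining a to e_1, ..., e_4 and to two further points
([splitting]). *)

(** * Minors, homogeneous forms and increasing row selections *)

Lemma homog_mevalZ (R : comNzRingType) n d (p : {mpoly R[n]}) (c : R)
    (v : 'I_n -> R) :
  p \is d.-homog -> p.@[fun j => c * v j] = c ^+ d * p.@[v].
Proof.
move=> /dhomogP hp; rewrite !mevalE mulr_sumr big_seq [RHS]big_seq.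
apply: eq_bigr => m /hp dm; rewrite mulrCA; congr (_ * _).
under eq_bigr => j _ do rewrite exprMn.
rewrite big_split /=; congr (_ * _).
by rewrite -dm prodrXr; congr (_ ^+ _); rewrite -mdegE.
Qed.

(** A maximal-rank row selection comes as an injective map, while minors are
indexed by increasing ones: sorting the image passes from one to the other. *)
Lemma injective_increasing_enum m n (f : 'I_n -> 'I_m) : injective f ->
  exists r : 'I_n -> 'I_m,
    (forall a b : 'I_n, (a < b)%N -> (r a < r b)%N) /\
    (forall a, exists b, f a = r b).
Proof.
move=> f_inj; pose s := [seq x <- enum 'I_m | x \in codom f].
have sz_s : size s = n.
  have /perm_size -> : perm_eq s (codom f).
    apply: uniq_perm; first by rewrite filter_uniq ?enum_uniq.
      exact/injectiveP.
    by move=> x; rewrite mem_filter mem_enum andbT.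
  by rewrite size_codom card_ord.
have s_sorted : sorted ltn (map val s).
  have -> : map val s = [seq x <- iota 0 m | x \in map val (codom f)].
    rewrite -val_enum_ord filter_map; congr map.
    by apply: eq_filter => x /=; rewrite mem_map //; exact: val_inj.
  exact: (sorted_filter ltn_trans _ (iota_ltn_sorted 0 m)).
exists (fun a => tnth (in_tuple s) (cast_ord (esym sz_s) a)); split.
  move=> a b ab; have x0 := tnth (in_tuple s) (cast_ord (esym sz_s) a).
  rewrite !(tnth_nth x0) /= -!(nth_map x0 (val x0)) ?sz_s //.
  by rewrite (sorted_ltn_nth ltn_trans) // inE size_map sz_s.
move=> a; have fa : f a \in in_tuple s.
  by rewrite mem_filter codom_f mem_enum.
have /tnthP [b ->] := fa.
by exists (cast_ord sz_s b); rewrite cast_ordK.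
Qed.

(** The rank drops below the number of columns iff all maximal minors vanish;
the minors with increasing rows suffice, since permuting rows only changes a
sign. *)
Lemma all_minors0P (F : fieldType) m n (A : 'M[F]_(m, n)) :
  (forall r : 'I_n -> 'I_m, (forall a b : 'I_n, (a < b)%N -> (r a < r b)%N) ->
     \det (rowsub r A) = 0) <-> (exists2 p : 'cV_n, p != 0 & A *m p = 0).
Proof.
split=> [minors0 | [p p0 Ap] r _]; last first.
  apply/eqP; rewrite -det_tr; apply/det0P; exists p^T; first by rewrite trmx_eq0.
  rewrite -trmx_mul mul_rowsub_mx Ap (_ : rowsub r 0 = 0) ?trmx0 //.
  by apply/matrixP => a b; rewrite !mxE.
have [A_full|A_nfull] := boolP (row_full A); last first.
  have : kermx A^T != 0 by rewrite kermx_eq0 /row_free mxrank_tr.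
  rewrite -nz_row_eq0 => p0; exists (nz_row (kermx A^T))^T.
    by rewrite trmx_eq0.
  apply/trmx_inj; rewrite trmx_mul trmxK trmx0.
  by apply/sub_kermxP; exact: nz_row_sub.
have [r [r_incr r_cover]] := injective_increasing_enum (@fullrankfun_inj _ _ _ _ A_full).
have : row_full (rowsub r A).
  have := fullrowsub_full A_full; rewrite -!sub1mx => /submx_trans; apply.
  apply/row_subP => a; rewrite row_rowsub.
  by have [b ->] := r_cover a; rewrite -row_rowsub row_sub.
by rewrite row_full_unit unitmxE (minors0 r r_incr) unitr0.
Qed.

(** * The relations of the algebra and the kernel of M(gamma) *)

(** Case analysis that leaves the indices in the numeral form in which the
coordinates of points are given. *)
Lemma I4_ind (P : 'I_4 -> Prop) : P 0 -> P 1 -> P 2 -> P 3 -> forall s, P s.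
Proof.
move=> P0 P1 P2 P3 [[|[|[|[|//]]]] lts].
- by rewrite (_ : Ordinal lts = 0) //; apply: val_inj.
- by rewrite (_ : Ordinal lts = 1) //; apply: val_inj.
- by rewrite (_ : Ordinal lts = 2) //; apply: val_inj.
by rewrite (_ : Ordinal lts = 3) //; apply: val_inj.
Qed.

Lemma sum_I4 (V : nmodType) (f : 'I_4 -> V) :
  \sum_s f s = f 0 + f 1 + f 2 + f 3.
Proof.
rewrite !big_ord_recr big_ord0 /= add0r.
by congr (f _ + f _ + f _ + f _); apply: val_inj.
Qed.

(** Specializing the generic u, v turns the polynomial identity defining the form
of a minor into a statement on the actual minors at u and v. *)
Lemma minor_form_eval (R : comNzRingType) (i gamma : R) r q
    (u v : 'I_4 -> R) : minor_form i gamma r q ->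
  q.@[tnth (plucker u v)] =
  \det (rowsub r (row_mx (half_mx i gamma u) (half_mx i gamma v))).
Proof.
case=> _ qE.
pose w (c : 'I_(4 + 4)) := match fintype.split c with inl s => u s | inr s => v s end.
have wu s : (u_var R s).@[w] = u s.
  by rewrite /u_var mevalXU /w (unsplitK (inl _ s)).
have wv s : (v_var R s).@[w] = v s.
  by rewrite /v_var mevalXU /w (unsplitK (inr _ s)).
have half_eval (x : 'I_4 -> {mpoly R[4 + 4]}) y : (forall s, (x s).@[w] = y s) ->
    map_mx (meval w) (half_mx i%:MP gamma%:MP x) = half_mx i gamma y.
  move=> xy; apply/matrixP => a b; rewrite !mxE.
  case: a => [[|[|[|[|[|[|[|[|[|[|a]]]]]]]]]] lta] //=;
  case: b => [[|[|[|[|b]]]] ltb] //=;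
  by rewrite ?mevalN ?mevalM ?mevalC ?xy ?meval0.
transitivity ((q \mPo plucker (u_var R) (v_var R)).@[w]).
  rewrite comp_mpoly_meval; apply: meval_eq => j.
  case: j => [[|[|[|[|[|[|//]]]]]] ltj];
  by rewrite !(tnth_nth 0) /= !mevalB !mevalM !wu !wv.
rewrite qE -det_map_mx map_mxsub map_row_mx.
by rewrite (half_eval _ _ wu) (half_eval _ _ wv).
Qed.

(** The coefficient matrix of a general quadratic relation: the (s, t) entry is the
coefficient of x_s x_t in the combination with weights l of the relations
x_4 x_1 - i x_1 x_4, x_3^2 - x_1^2, x_3 x_1 - x_1 x_3 + x_2^2,
x_3 x_2 - i x_2 x_3, x_4^2 - x_2^2, x_4 x_2 - x_2 x_4 + gamma x_1^2. *)
Definition relation_mx (R : comNzRingType) (i gamma : R) (l : 'rV[R]_6) : 'M[R]_4 :=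
  let l1 := l 0 0 in let l2 := l 0 1 in let l3 := l 0 2 in
  let l4 := l 0 3 in let l5 := l 0 4 in let l6 := l 0 5 in
  let rows :=
    [:: [:: gamma * l6 - l2; 0; - l3; - i * l1];
        [:: 0; l3 - l5; - i * l4; - l6];
        [:: l3; l4; l2; 0];
        [:: l1; l6; 0; l5]] in
  \matrix_(s, t) nth 0 (nth [::] rows s) t.

(** M(gamma) (p, q) depends only on the tensor T = u (x) p + v (x) q: its entries
are the ten linear equations that cut out the relations among all tensors. *)
Lemma half_mx_tensor (R : comNzRingType) (i gamma : R)
    (u v : 'I_4 -> R) (p q : 'cV_4) (T := fun s t => u s * p t 0 + v s * q t 0) :
  half_mx i gamma u *m p + half_mx i gamma v *m q =
  \col_a nth 0 [:: T 0 1; T 1 0; T 2 3; T 3 2; T 2 0 + T 0 2; T 3 1 + T 1 3;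
                   i * T 0 3 - T 3 0; i * T 1 2 - T 2 1;
                   T 0 0 + T 2 2 + gamma * T 1 3; T 1 1 + T 0 2 + T 3 3] a.
Proof.
rewrite /T; apply/matrixP => a b; rewrite (ord1 b) {b} !mxE !sum_I4.
by case: a => [[|[|[|[|[|[|[|[|[|[|a]]]]]]]]]] lta] //; rewrite !mxE /=; ring.
Qed.

Lemma half_mx_kernelP (R : comNzRingType) (i gamma : R) (i2 : i ^+ 2 = -1)
    (u v : 'I_4 -> R) (p q : 'cV_4) :
  half_mx i gamma u *m p + half_mx i gamma v *m q = 0 <->
  exists l, forall s t, u s * p t 0 + v s * q t 0 = relation_mx i gamma l s t.
Proof.
rewrite half_mx_tensor; split=> [/matrixP ker0 | [l lE]]; last first.
  apply/matrixP => a b; rewrite !mxE !lE !mxE /=.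
  by case: a => [[|[|[|[|[|[|[|[|[|[|a]]]]]]]]]] lta] //=; ring: i2.
have {ker0} E (a : nat) (lta : (a < 10)%N) := ker0 (Ordinal lta) 0.
pose T s t := u s * p t 0 + v s * q t 0.
exists (\row_j nth 0 [:: T 3 0; T 2 2; T 2 0; T 2 1; T 3 3; T 3 1] j).
move: (E 0 isT) (E 1 isT) (E 2 isT) (E 3 isT) (E 4 isT) (E 5 isT) (E 6 isT)
  (E 7 isT) (E 8 isT) (E 9 isT); rewrite !mxE /= -!/(T _ _).
move=> T01 T10 T23 T32.
move=> /eqP; rewrite addr_eq0 => /eqP T20 /eqP; rewrite addr_eq0 => /eqP T31.
move=> /eqP; rewrite subr_eq0 => /eqP T30 /eqP; rewrite subr_eq0 => /eqP T21.
move=> T00 T11.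
have {}T00 : T 0 0 = - T 2 2 - gamma * T 1 3
  by rewrite -[LHS]subr0 -[X in _ - X = _]T00; ring.
have {}T11 : T 1 1 = - T 0 2 - T 3 3
  by rewrite -[LHS]subr0 -[X in _ - X = _]T11; ring.
by elim/I4_ind; elim/I4_ind; rewrite -/(T _ _) !mxE /= ?mxE /=;
  rewrite ?T00 ?T11 ?T01 ?T10 ?T23 ?T32 ?T20 ?T31 -?T30 -?T21; ring: i2.
Qed.

(** * The linear forms vanishing on a line *)

(** The skew matrix of the coordinates N_st dual to the Pluecker coordinates of
the line through a and b. *)
Definition dual_mx (R : comNzRingType) (a b : 'I_4 -> R) : 'M[R]_4 :=
  let m (s t : 'I_4) := a s * b t - a t * b s in
  let rows :=
    [:: [:: 0; m 2 3; - m 1 3; m 1 2];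
        [:: - m 2 3; 0; m 0 3; - m 0 2];
        [:: m 1 3; - m 0 3; 0; m 0 1];
        [:: - m 1 2; m 0 2; - m 0 1; 0]] in
  \matrix_(s, t) nth 0 (nth [::] rows s) t.

Section DualLine.
Variables (R : comNzRingType) (a b : 'I_4 -> R).

Lemma dual_mx_orth s :
  \sum_j a j * dual_mx a b s j = 0 /\ \sum_j b j * dual_mx a b s j = 0.
Proof. by rewrite !sum_I4; elim/I4_ind: s; rewrite !mxE /=; split; ring. Qed.

Lemma dual_mx_alt s t : dual_mx a b s s = 0 /\ dual_mx a b s t = - dual_mx a b t s.
Proof.
by elim/I4_ind: s; elim/I4_ind: t; rewrite !mxE /= ?opprK ?oppr0.
Qed.

(** When the (s, t) entry is nonzero, the rows s and t span all the linear forms w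
vanishing on a and b.  For distinct s, t, j with fourth index m, the difference
of the two sides is, up to sign, b_m (a . w) - a_m (b . w). *)
Lemma dual_mx_expand (w : 'I_4 -> R) s t j :
  \sum_m a m * w m = 0 -> \sum_m b m * w m = 0 ->
  dual_mx a b s t * w j = dual_mx a b s j * w t - dual_mx a b t j * w s.
Proof.
move=> aw bw; apply/eqP; rewrite -subr_eq0; apply/eqP.
have K m : b m * (\sum_m a m * w m) - a m * (\sum_m b m * w m) = 0.
  by rewrite aw bw !mulr0 subr0.
move: (K 0) (K 1) (K 2) (K 3); rewrite !sum_I4 => K0 K1 K2 K3 {K aw bw}.
by elim/I4_ind: s; elim/I4_ind: t; elim/I4_ind: j; rewrite !mxE /=;
  first [ring | (rewrite -[RHS]K0; ring) | (apply: oppr_inj; rewrite oppr0 -[RHS]K0; ring)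
  | (rewrite -[RHS]K1; ring) | (apply: oppr_inj; rewrite oppr0 -[RHS]K1; ring)
  | (rewrite -[RHS]K2; ring) | (apply: oppr_inj; rewrite oppr0 -[RHS]K2; ring)
  | (rewrite -[RHS]K3; ring) | (apply: oppr_inj; rewrite oppr0 -[RHS]K3; ring)].
Qed.

(** The skew matrix has rank two, so the 2 x 2 minors of two of its rows reproduce
the whole matrix up to the factor D_st; this is the Pluecker relation. *)
Lemma plucker_dual_mx s t j :
  tnth (plucker (dual_mx a b s) (dual_mx a b t)) j =
  dual_mx a b s t * (tnth (dual_coords R) j).@[tnth (plucker a b)].
Proof.
rewrite (tnth_nth 0) [in RHS](tnth_nth 0).
case: j => [[|[|[|[|[|[|//]]]]]] ltj] /=; rewrite ?mevalN mevalXU (tnth_nth 0) /=;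
by elim/I4_ind: s; elim/I4_ind: t; rewrite !mxE /=; ring.
Qed.

Lemma dual_mx_neq0 : (exists j, tnth (plucker a b) j != 0) ->
  exists s t, dual_mx a b s t != 0.
Proof.
have E s t x : dual_mx a b s t = x -> x != 0 -> exists s t, dual_mx a b s t != 0.
  by move=> <- ?; exists s, t.
by case=> [[[|[|[|[|[|[|//]]]]]] ltj]]; rewrite (tnth_nth 0) /=;
  [apply: (E 2 3) | apply: (E 3 1) | apply: (E 1 2)
  | apply: (E 0 3) | apply: (E 2 0) | apply: (E 0 1)]; rewrite mxE.
Qed.

End DualLine.

(** * Parametrized lines and relations of rank at most two *)

Section RankTwoRelations.
Variables (k : fieldType) (i gamma : k).
Hypotheses (i2 : i ^+ 2 = -1) (two0 : (2 : k) != 0).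

Lemma relation_mx0 l : relation_mx i gamma l = 0 -> l = 0.
Proof.
move/matrixP=> Q0; apply/rowP => j.
move: (Q0 2 0) (Q0 2 1) (Q0 2 2) (Q0 3 0) (Q0 3 1) (Q0 3 3).
rewrite !mxE /= => l3 l4 l2 l1 l6 l5.
case: j => [[|[|[|[|[|[|//]]]]]] ltj].
- by rewrite -[RHS]l1; congr (l _ _); apply: val_inj.
- by rewrite -[RHS]l2; congr (l _ _); apply: val_inj.
- by rewrite -[RHS]l3; congr (l _ _); apply: val_inj.
- by rewrite -[RHS]l4; congr (l _ _); apply: val_inj.
- by rewrite -[RHS]l5; congr (l _ _); apply: val_inj.
- by rewrite -[RHS]l6; congr (l _ _); apply: val_inj.
Qed.

(** The conditions on the coordinates s and t make u and v independent, so a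
nonzero (p, q) gives a nonzero tensor. *)
Lemma half_mx_minors0P (u v : 'I_4 -> k) s t (c : k) :
  c != 0 -> u s = 0 -> u t = c -> v s = - c -> v t = 0 ->
  (forall r : 'I_8 -> 'I_10, (forall a b : 'I_8, (a < b)%N -> (r a < r b)%N) ->
     \det (rowsub r (row_mx (half_mx i gamma u) (half_mx i gamma v))) = 0) <->
  (exists l (p q : 'cV_4), l != 0 /\
     forall s t, u s * p t 0 + v s * q t 0 = relation_mx i gamma l s t).
Proof.
move=> c0 us ut vs vt.
apply: (iff_trans (all_minors0P (row_mx (half_mx i gamma u) (half_mx i gamma v)))).
split=> [[p p0] | [l [p [q [l0 lE]]]]].
  rewrite -[p](vsubmxK (p : 'cV_(4 + 4))) mul_row_col => /(half_mx_kernelP _ i2) [l lE].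
  exists l, (usubmx (p : 'cV_(4 + 4))), (dsubmx (p : 'cV_(4 + 4))); split=> //.
  apply: contraNneq p0 => l0; rewrite -[p](vsubmxK (p : 'cV_(4 + 4))).
  have Q0 s' t' : relation_mx i gamma l s' t' = 0.
    rewrite l0; elim/I4_ind: s'; elim/I4_ind: t'; rewrite !mxE /= ?mxE; ring.
  rewrite -[0]vsubmxK; apply/eqP; congr col_mx.
    apply/colP => j; have := lE t j; rewrite Q0 ut vt mul0r addr0.
    by move/eqP; rewrite mulf_eq0 (negPf c0) => /eqP ->; rewrite !mxE.
  apply/colP => j; have := lE s j; rewrite Q0 us vs mul0r add0r.
  by move/eqP; rewrite mulf_eq0 oppr_eq0 (negPf c0) => /eqP ->; rewrite !mxE.
exists (col_mx p q : 'cV_(4 + 4)).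
  apply: contraNneq l0 => /eqP; rewrite col_mx_eq0 => /andP [/eqP p0 /eqP q0].
  apply/eqP/relation_mx0/matrixP => s' t'.
  by rewrite -lE p0 q0 !mxE !mulr0 addr0.
by rewrite (mul_row_col (half_mx i gamma u)); apply/half_mx_kernelP => //; exists l.
Qed.

(** Two rows u = D_s, v = D_t of the dual matrix serve as basis of the linear forms
vanishing on the line.  Their Pluecker coordinates are D_st times the dual
coordinates, and the forms of the minors are quartic, so the equations of the
line scheme at the line are the minors at u, v up to the nonzero factor D_st^4. *)
Lemma closed_point_line_schemeP (a b : 'I_4 -> k) :
  closed_point (line_scheme_eqs i gamma) (\row_j tnth (plucker a b) j) <->
  (exists j, tnth (plucker a b) j != 0) /\
  (exists2 l, l != 0 & forall t, \sum_s a s * relation_mx i gamma l s t = 0 /\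
                                 \sum_s b s * relation_mx i gamma l s t = 0).
Proof.
set M := \row_j _.
have M0 j : M 0 j = tnth (plucker a b) j by rewrite mxE.
have MP : M != 0 <-> exists j, tnth (plucker a b) j != 0.
  split=> [M_neq0 | [j bj]]; last first.
    by apply: contraNneq bj => /rowP /(_ j); rewrite !mxE => ->.
  have /rV0Pn [j] := M_neq0; rewrite M0 => Mj; by exists j.
pose D := dual_mx a b.
pose N j := (tnth (dual_coords k) j).@[M 0].
have DN s t j : tnth (plucker (D s) (D t)) j = D s t * N j.
  by rewrite plucker_dual_mx; congr (_ * _); apply: meval_eq => j'; rewrite M0.
have minor_dual s t r q : minor_form i gamma r q ->
    D s t ^+ 4 * (q \mPo dual_coords k).@[M 0] =
    \det (rowsub r (row_mx (half_mx i gamma (D s)) (half_mx i gamma (D t)))).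
  move=> qE; rewrite -(minor_form_eval _ _ qE) comp_mpoly_meval.
  rewrite -(homog_mevalZ _ _ qE.1); apply: meval_eq => j.
  by rewrite DN.
have Dss s : D s s = 0 by have [] := dual_mx_alt a b s s.
have Dalt s t : D s t = - D t s by have [] := dual_mx_alt a b s t.
split=> [[/MP Mn0 closedM] | [Mn0 [l l0 abl]]].
  split=> //; have [s [t Dst]] := dual_mx_neq0 Mn0.
  have [|l [p [q [l0 lE]]]] := (half_mx_minors0P Dst (Dss s) erefl (Dalt t s) (Dss t)).1.
    move=> r r_incr; have [q qE] := minor_form_exists i gamma r two0.
    rewrite -(minor_dual _ _ _ _ qE) closedM ?mulr0 //.
    by right; exists r, q.
  exists l => // t'.
  have orth (w : 'I_4 -> k) :
      \sum_j w j * D s j = 0 -> \sum_j w j * D t j = 0 ->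
      \sum_j w j * relation_mx i gamma l j t' = 0.
    move=> ws wt; under eq_bigr => j _ do rewrite -lE mulrDr !mulrA.
    by rewrite big_split /= -!mulr_suml ws wt !mul0r addr0.
  have [[as0 bs0] [at0 bt0]] := (dual_mx_orth a b s, dual_mx_orth a b t).
  by split; apply: orth.
split; first exact/MP; have [s [t Dst]] := dual_mx_neq0 Mn0.
move=> _ [-> | [r [q [r_incr qE ->]]]].
  rewrite /plucker_poly mevalD mevalB !mevalM !mevalXU !M0 !(tnth_nth 0) /=; ring.
have /eqP := minor_dual s t r q qE.
rewrite (half_mx_minors0P Dst (Dss s) erefl (Dalt t s) (Dss t)).2 //; last first.
  exists l, (\col_j (relation_mx i gamma l t j / D s t)),
    (\col_j (- (relation_mx i gamma l s j / D s t))); split=> // s' t'.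
  have [aQ bQ] := abl t'.
  have /(congr1 (fun x => x / D s t)) := dual_mx_expand s t s' aQ bQ.
  rewrite mulrAC mulfV // mul1r => ->.
  by rewrite !mxE; ring.
by rewrite mulf_eq0 expf_eq0 /= (negPf Dst) => /eqP.
Qed.

(** If all a_s b_t - a_t b_s vanish, b is a multiple of a as soon as a is nonzero. *)
Lemma dim2_plucker (a b : 'rV[k]_4) : \dim (<[a]> + <[b]>) = 2%N ->
  exists j, tnth (plucker (a 0) (b 0)) j != 0.
Proof.
move=> dim2; apply/existsP; apply: contraPT dim2.
rewrite negb_exists => /forallP /= ab0; apply/eqP.
have {}ab0 (j : 'I_6) : nth 0 (plucker (a 0) (b 0)) j = 0.
  by have := ab0 j; rewrite negbK (tnth_nth 0) => /eqP.
have ab s t : a 0 s * b 0 t = a 0 t * b 0 s.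
  apply/eqP; rewrite -subr_eq0; apply/eqP.
  move: (ab0 0) (ab0 1) (ab0 2) (ab0 3) (ab0 4) (ab0 5); rewrite /=.
  by elim/I4_ind: s; elim/I4_ind: t => //; rewrite ?subrr // => h0 h1 h2 h3 h4 h5;
    apply: oppr_inj; rewrite opprB oppr0.
suff [c h] : exists c, (<[a]> + <[b]> <= <[c]>)%VS.
  apply: contraTneq (dimvS h) => ->; rewrite -ltnNge.
  by rewrite dim_vline; case: (c != 0).
have [-> | /rV0Pn [j aj]] := eqVneq a 0.
  by exists b; rewrite subv_add subvv andbT -memvE mem0v.
exists a; rewrite subv_add subvv /= -memvE; apply/vlineP; exists (b 0 j / a 0 j).
by apply/rowP => s; rewrite mxE mulrAC [X in X / _]mulrC ab mulrC mulKf.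
Qed.

(** In this form the criterion is independent of the points spanning the line. *)
Lemma parametrized_linesP (l : {vspace 'rV[k]_4}) :
  parametrized_lines i gamma l <->
  \dim l = 2%N /\ (exists2 m, m != 0 &
                     forall w, w \in l -> w *m relation_mx i gamma m = 0).
Proof.
split=> [[a [b [-> dim2 /closed_point_line_schemeP [_ [m m0 abm]]]]] | [dim2 [m m0 lm]]].
  split=> //; exists m => // w /memv_addP [_ /vlineP [c ->] [_ /vlineP [d ->] ->]].
  apply/rowP => t; rewrite mulmxDl -!scalemxAl !mxE.
  by have [-> ->] := abm t; rewrite !mulr0 addr0.
have lE : l = (<[(vbasis l)`_0]> + <[(vbasis l)`_1]>)%VS.
  rewrite -[LHS](span_basis (vbasisP l)).
  have : size (vbasis l) = 2%N by rewrite size_tuple.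
  by case: (tval (vbasis l)) => [|a [|b []]] // _; rewrite span_cons span_seq1.
exists (vbasis l)`_0, (vbasis l)`_1; rewrite -lE; split=> //.
apply/closed_point_line_schemeP; split; first by apply: dim2_plucker; rewrite -lE.
exists m => // t.
have lm0 w : w \in l -> \sum_s w 0 s * relation_mx i gamma m s t = 0.
  by move/lm => /rowP /(_ t); rewrite !mxE.
by split; apply/lm0; rewrite memvE [X in (_ <= X)%VS]lE ?addvSl ?addvSr.
Qed.

End RankTwoRelations.

Lemma lines_throughP (k : fieldType) (i gamma : k) (i2 : i ^+ 2 = -1)
    (two0 : (2 : k) != 0) (a b : 'rV[k]_4) :
  a != 0 -> b \notin <[a]>%VS ->
  lines_through i gamma a (<[a]> + <[b]>)%VS <->
  (exists2 l, l != 0 & a *m relation_mx i gamma l = 0 /\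
                       b *m relation_mx i gamma l = 0).
Proof.
move=> a0 ba; split=> [[/(parametrized_linesP _ i2 two0) [_ [l l0 abl]] _] | [l l0 [al bl]]].
  by exists l => //; split; apply: abl; rewrite memvE ?addvSl ?addvSr.
split; last by rewrite memvE addvSl.
apply/(parametrized_linesP _ i2 two0); split.
  have : free [:: b; a] by rewrite free_cons span_seq1 ba seq1_free.
  by rewrite /free span_cons span_seq1 addvC => /eqP.
exists l => // w /memv_addP [_ /vlineP [c ->] [_ /vlineP [d ->] ->]].
by rewrite mulmxDl -!scalemxAl al bl !scaler0 addr0.
Qed.

(** * Infinitely many lines through the vertices *)

Lemma infinite_set_inj_nat (T : Type) (A : set T) (f : nat -> T) :
  (forall n, A (f n)) -> injective f -> infinite_set A.
Proof.
move=> fA f_inj; apply: (@sub_infinite_set _ (range f)).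
  by move=> _ [n _ <-]; exact: fA.
apply/infiniteP; rewrite (card_le_eqr (@inj_card_eq _ _ setT f _)) ?card_lexx //.
by move=> m n _ _; exact: f_inj.
Qed.

Lemma exists_sqrt (k : closedFieldType) (c : k) : exists y, y ^+ 2 = c.
Proof.
have [y yE] := @solve_monicpoly k 2%N (fun n => if n is 0%N then c else 0) isT.
by exists y; rewrite yE !big_ord_recl big_ord0 /= expr0 mulr1 mul0r !addr0.
Qed.

Section Vertices.
Variables (k : closedFieldType) (i gamma : k).
Hypotheses (char0 : [pchar k] =i pred0) (i2 : i ^+ 2 = -1) (gamma0 : gamma != 0).

Lemma i_neq0 : i != 0.
Proof. by apply: contraNneq (oner_neq0 k) => i0; rewrite -oppr_eq0 -i2 i0 expr0n. Qed.

Lemma two_neq0 : (2 : k) != 0.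
Proof. by rewrite ((pcharf0P k).1 char0). Qed.

(** Normalizing a coordinate of the second point to 1 makes another coordinate t an
invariant of the line through e_j, and the positive integers already provide
infinitely many values of t in characteristic zero. *)
Lemma infinite_lines_of_normalized_points (j s m : 'I_4) : s != j -> m != j ->
  (forall t : k, t != 0 -> exists b : 'rV[k]_4, [/\ b 0 s = t, b 0 m = 1 &
     exists2 l, l != 0 & (delta_mx 0 j : 'rV_4) *m relation_mx i gamma l = 0 /\
                         b *m relation_mx i gamma l = 0]) ->
  infinite_set (lines_through i gamma (delta_mx 0 j)).
Proof.
move=> sj mj exb; pose t (n : nat) : k := n.+1%:R.
have t0 n : t n != 0 by rewrite ((pcharf0P k).1 char0).
have [b bP] := classical.boolp.choice (fun n => exb (t n) (t0 n)).
pose e : 'rV[k]_4 := delta_mx 0 j.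
apply: (@infinite_set_inj_nat _ _ (fun n => (<[e]> + <[b n]>)%VS)).
  move=> n; have [_ bm bl] := bP n; apply/(lines_throughP _ i2 two_neq0) => //.
    by apply/eqP => /rowP /(_ j) /eqP; rewrite !mxE !eqxx oner_eq0.
  apply/vlineP => -[c /rowP /(_ m) /eqP].
  by rewrite bm !mxE (negPf mj) andbF mulr0 oner_eq0.
move=> n n' /= bnn'.
have : b n \in (<[e]> + <[b n']>)%VS by rewrite -bnn' memvE addvSr.
case/memv_addP => _ /vlineP [c ->] [_ /vlineP [d ->] bE].
have coord r : r != j -> b n 0 r = d * b n' 0 r.
  by move=> rj; rewrite {1}bE !mxE (negPf rj) andbF mulr0 add0r.
have [[bs bm _] [bs' bm' _]] := (bP n, bP n').
have := coord m mj; rewrite bm bm' mulr1 => d1.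
have := coord s sj; rewrite bs bs' -d1 mul1r => /eqP.
rewrite /t -subr_eq0; case: (leqP n n') => [|/ltnW] le_nn'.
  rewrite -oppr_eq0 opprB -natrB // ((pcharf0P k).1 char0) subSS subn_eq0 => ?.
  by apply/eqP; rewrite eqn_leq le_nn'.
rewrite -natrB // ((pcharf0P k).1 char0) subSS subn_eq0 => ?.
by apply/eqP; rewrite eqn_leq le_nn' andbT.
Qed.

(** With the j-th row of the relation matrix zero, b Q = 0 is a linear system in
the three remaining weights whose determinant is a cubic in b, even in one of
its coordinates y; the vector of weights given for each vertex is its kernel. *)
Lemma infinite_lines_through_vertex (j : 'I_4) :
  infinite_set (lines_through i gamma (delta_mx 0 j)).
Proof.
have row_neq0 (s : seq k) n (ltn : (n < 6)%N) : nth 0 s n != 0 ->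
    \row_(r < 6) nth 0 s r != 0 :> 'rV[k]_6.
  by apply: contraNneq => /rowP /(_ (Ordinal ltn)); rewrite !mxE => ->.
elim/I4_ind: j.
- apply: (@infinite_lines_of_normalized_points 0 1 3) => // t t0.
  have [y yE] := exists_sqrt ((i * t ^+ 3 - i * t) / gamma).
  have {}yE : gamma * y ^+ 2 = i * t ^+ 3 - i * t by rewrite yE mulrC divfK.
  exists (\row_r nth 0 [:: 0; t; y; 1] r); split; rewrite ?mxE //.
  exists (\row_r nth 0 [:: 0; gamma * i * t; 0; gamma * y; i * t ^+ 2; i * t] r).
    by apply: (row_neq0 _ 5) => //=; rewrite mulf_neq0 ?i_neq0.
  by rewrite -rowE; split; apply/rowP; elim/I4_ind;
    rewrite !mxE ?sum_I4 ?mxE /= ?mxE /=; ring: yE.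
- apply: (@infinite_lines_of_normalized_points 1 0 2) => // t t0.
  have [y yE] := exists_sqrt (i * t ^+ 3 - i * t).
  exists (\row_r nth 0 [:: t; 0; 1; y] r); split; rewrite ?mxE //.
  exists (\row_r nth 0 [:: y; i * t ^+ 2; i * t; 0; i * t; 0] r).
    by apply: (row_neq0 _ 2) => //=; rewrite mulf_neq0 ?i_neq0.
  by rewrite -rowE; split; apply/rowP; elim/I4_ind;
    rewrite !mxE ?sum_I4 ?mxE /= ?mxE /=; ring: yE.
- apply: (@infinite_lines_of_normalized_points 2 1 3) => // t t0.
  have [y yE] := exists_sqrt ((t ^+ 2 - 1) / (i * gamma * t)).
  have {}yE : i * gamma * t * y ^+ 2 = t ^+ 2 - 1.
    by rewrite yE mulrC divfK // !mulf_neq0 ?i_neq0.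
  exists (\row_r nth 0 [:: y; t; 0; 1] r); split; rewrite ?mxE //.
  exists (\row_r nth 0 [:: - gamma * y * t; 0; 0; 0; 1; t] r).
    by apply: (row_neq0 _ 4) => //=; rewrite oner_neq0.
  by rewrite -rowE; split; apply/rowP; elim/I4_ind;
    rewrite !mxE ?sum_I4 ?mxE /= ?mxE /=; ring: yE.
apply: (@infinite_lines_of_normalized_points 3 0 2) => // t t0.
have [y yE] := exists_sqrt ((t ^+ 2 - 1) / (i * t)).
have {}yE : i * t * y ^+ 2 = t ^+ 2 - 1.
  by rewrite yE mulrC divfK // !mulf_neq0 ?i_neq0.
exists (\row_r nth 0 [:: t; y; 1; 0] r); split; rewrite ?mxE //.
exists (\row_r nth 0 [:: 0; 1; t; - t * y; 0; 0] r).
  by apply: (row_neq0 _ 1) => //=; rewrite oner_neq0.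
by rewrite -rowE; split; apply/rowP; elim/I4_ind;
    rewrite !mxE ?sum_I4 ?mxE /= ?mxE /=; ring: yE.
Qed.

End Vertices.

(** * Six lines through a point of Z_gamma *)

Section PointOfZgamma.
Variables (k : closedFieldType) (i gamma : k).
Hypotheses (char0 : [pchar k] =i pred0) (i2 : i ^+ 2 = -1) (gamma0 : gamma != 0).
Variable a : 'rV[k]_4.
Hypothesis aZ : Zgamma i gamma a.
Let x := a 0 1.
Let y := a 0 2.
Let z := a 0 3.

Let a0 : a 0 0 = 1. Proof. by have [] := aZ. Qed.

Let ynz2 : i * y * z ^+ 2 = y ^+ 2 - 1.
Proof.
have [_ _ h _] := aZ; apply/eqP; rewrite -subr_eq0 -oppr_eq0 -[X in _ == X]h.
by apply/eqP; rewrite -/y -/z; ring.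
Qed.

Let y_neq0 : y != 0.
Proof.
apply: contra_eq_neq ynz2 => ->; rewrite mulr0 mul0r expr0n sub0r eq_sym.
by rewrite oppr_eq0 oner_neq0.
Qed.

Let z_neq0 : z != 0.
Proof.
have [_ h _ _] := aZ; apply: contraNneq gamma0 => z0; rewrite -sqrf_eq0 -h -/z z0.
by rewrite !expr0n /= mulr0 subr0 add0r.
Qed.

Let gx : gamma * x = i * z ^+ 3 * (1 + y ^+ 2).
Proof.
have [_ _ _ h] := aZ; rewrite -[LHS]subr0 -h -/x -/y -/z.
have -> : y * z ^+ 5 = - i * z ^+ 3 * (i * y * z ^+ 2) by ring: i2.
by rewrite ynz2; ring.
Qed.

(** This comes from the equation of degree 8 by
4 y^2 - y^2 z^4 = 4 y^2 + (y^2 - 1)^2 = (1 + y^2)^2. *)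
Let g2y2 : gamma ^+ 2 * y ^+ 2 = z ^+ 4 * (1 + y ^+ 2) ^+ 2.
Proof.
have [_ h _ _] := aZ.
rewrite -[gamma ^+ 2]subr0 -[X in _ - X]h -/z.
have -> : (gamma ^+ 2 - (z ^+ 8 - 4 * z ^+ 4 + gamma ^+ 2)) * y ^+ 2 =
          z ^+ 4 * (4 * y ^+ 2 + (i * y * z ^+ 2) ^+ 2) by ring: i2.
by rewrite ynz2; ring.
Qed.

Let x2 : x ^+ 2 = - (y ^+ 2 * z ^+ 2).
Proof.
apply: (@mulfI _ (gamma ^+ 2)); first by rewrite sqrf_eq0.
rewrite -exprMn gx mulrN [in RHS]mulrA g2y2; ring: i2.
Qed.

Let x_neq0 : x != 0.
Proof. by rewrite -sqrf_eq0 x2 oppr_eq0 mulf_neq0 // sqrf_eq0. Qed.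

Let y2m1_neq0 : y ^+ 2 - 1 != 0.
Proof. by rewrite -ynz2 !mulf_neq0 ?sqrf_eq0 // (i_neq0 i2). Qed.

Let a_neq0 j : a 0 j != 0.
Proof. by elim/I4_ind: j => //; rewrite a0 oner_neq0. Qed.

(** The first, third and fourth coordinates of a Q = 0 give the three conditions.
The second coordinate depends on the others: by the equations of Z_gamma,
y z^2 times it is -i x times the left side of the last condition once the other
conditions hold, so the relations killed by a form a space of dimension three. *)
Lemma relation_through_pointP (l : 'rV[k]_6) :
  a *m relation_mx i gamma l = 0 <->
  [/\ y * l 0 1 = l 0 2 + i * x * l 0 3, z * l 0 4 = i * l 0 0 + x * l 0 5
    & z * y * l 0 0 + (y ^+ 2 - 1) * l 0 2 - i * x * l 0 3 + gamma * y * l 0 5 = 0].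
Proof.
split=> [/rowP aQ | [l2E l5E rel]].
  move: (aQ 0) (aQ 2) (aQ 3); rewrite !mxE !sum_I4 !mxE /= a0 -/x -/y -/z.
  move=> E0 E2 E3; have l2E : y * l 0 1 = l 0 2 + i * x * l 0 3.
    by rewrite -[LHS]subr0 -[X in _ - X]E2; ring.
  split=> //.
    by rewrite -[LHS]subr0 -[X in _ - X]E3; ring.
  rewrite -[RHS](mulr0 y) -[X in _ = _ * X]E0.
  have -> : y * (1 * (gamma * l 0 5 - l 0 1) + x * 0 + y * l 0 2 + z * l 0 0) =
    y * gamma * l 0 5 - y * l 0 1 + y ^+ 2 * l 0 2 + y * z * l 0 0 by ring.
  by rewrite l2E; ring.
apply/rowP; elim/I4_ind; rewrite !mxE !sum_I4 !mxE /= a0 -/x -/y -/z.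
- apply: (mulfI y_neq0); rewrite [RHS]mulr0 -[RHS]rel.
  transitivity (y * gamma * l 0 5 - y * l 0 1 + y ^+ 2 * l 0 2 + y * z * l 0 0); first ring.
  by rewrite l2E; ring.
- apply: (mulfI z_neq0); apply: (mulfI z_neq0); apply: (mulfI y_neq0).
  rewrite !mulr0 -[RHS](mulr0 (- i * x)) -[X in _ = _ * X]rel.
  transitivity (z * y * (x * z * l 0 2 - x * (z * l 0 4) + y * z * l 0 3
                         + z ^+ 2 * l 0 5)); first by ring.
  transitivity (- i * x * z * y * l 0 0 - i * x * (y ^+ 2 - 1) * l 0 2
                - x ^+ 2 * l 0 3 - i * y * (gamma * x) * l 0 5); last first.
    by ring: i2.
  rewrite l5E; transitivity (- i * x * z * y * l 0 0 + x * y * z ^+ 2 * l 0 2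
    + y ^+ 2 * z ^+ 2 * l 0 3 + y * z * (z ^+ 2 - x ^+ 2) * l 0 5); first by ring.
  by rewrite gx -ynz2 x2; ring: i2.
- by rewrite !mulr0 addr0 l2E; ring.
by rewrite !mulr0 addr0 l5E; ring.
Qed.

Definition rescale (c : 'I_4 -> k) : 'rV[k]_4 := \row_j (c j * a 0 j).

(** Subtracting c_t times the t-th coordinate of a Q = 0 leaves four equations that
involve only the products A = l_3 (c_3 - c_1), B = l_1 (c_4 - c_1),
C = l_4 (c_3 - c_2), D = l_6 (c_4 - c_2); that linear system is invertible,
with determinant 2 x y z up to sign. *)
Lemma rescale_relation (c : 'I_4 -> k) (l : 'rV[k]_6) :
  a *m relation_mx i gamma l = 0 ->
  rescale c *m relation_mx i gamma l = 0 <->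
  [/\ l 0 2 * (c 2 - c 0) = 0, l 0 0 * (c 3 - c 0) = 0,
      l 0 3 * (c 2 - c 1) = 0 & l 0 5 * (c 3 - c 1) = 0].
Proof.
move=> al.
have -> : rescale c *m relation_mx i gamma l = \row_t nth 0
  [:: y * (l 0 2 * (c 2 - c 0)) + z * (l 0 0 * (c 3 - c 0));
      y * (l 0 3 * (c 2 - c 1)) + z * (l 0 5 * (c 3 - c 1));
      l 0 2 * (c 2 - c 0) + i * x * (l 0 3 * (c 2 - c 1));
      i * (l 0 0 * (c 3 - c 0)) + x * (l 0 5 * (c 3 - c 1))] t.
  have [l2E l5E _] := (relation_through_pointP l).1 al.
  move/rowP: al => aQ; move: (aQ 0) (aQ 1).
  rewrite !mxE !sum_I4 !mxE /= a0 -/x -/y -/z => E0 E1.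
  apply/rowP; elim/I4_ind; rewrite !mxE !sum_I4 !mxE /= a0 -/x -/y -/z.
  - by rewrite -[LHS]subr0 -(mulr0 (c 0)) -[X in _ - _ * X]E0; ring.
  - by rewrite -[LHS]subr0 -(mulr0 (c 1)) -[X in _ - _ * X]E1; ring.
  - transitivity (- c 0 * l 0 2 - c 1 * i * x * l 0 3 + c 2 * (y * l 0 1)); first by ring.
    by rewrite l2E; ring.
  transitivity (- c 0 * i * l 0 0 - c 1 * x * l 0 5 + c 3 * (z * l 0 4)); first by ring.
  by rewrite l5E; ring.
split=> [/rowP E | [-> -> -> ->]]; last first.
  by apply/rowP => t; elim/I4_ind: t; rewrite !mxE /= !mulr0 addr0.
move: (E 0) (E 1) (E 2) (E 3); rewrite !mxE /=.
set A := l 0 2 * _; set B := l 0 0 * _; set C := l 0 3 * _; set D := l 0 5 * _.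
move=> E0 E1 E2 E3.
have C0 : C = 0.
  apply: (@mulfI _ (2 * i * x * y)).
    by rewrite !mulf_neq0 ?(i_neq0 i2) // two_neq0.
  (* The combination of the four equations that eliminates A, B and D. *)
  rewrite mulr0; transitivity (y * (A + i * x * C) - i * z * (i * B + x * D)
    - (y * A + z * B) + i * x * (y * C + z * D)); first by ring: i2.
  by rewrite E0 E1 E2 E3 !mulr0 !subr0 addr0.
move: E1 E2; rewrite C0 !mulr0 add0r addr0 => /eqP + A0.
rewrite mulf_eq0 (negPf z_neq0) => /eqP D0; move: E3.
by rewrite D0 mulr0 addr0 => /eqP; rewrite mulf_eq0 (negPf (i_neq0 i2)) => /eqP.
Qed.

Lemma rescale_notin_line c j : c 0 = 0 -> c j != 0 -> rescale c \notin <[a]>%VS.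
Proof.
move=> c0 cj; apply/vlineP => -[d /rowP E].
have := E 0; rewrite !mxE c0 mul0r a0 mulr1 => d0.
by have /eqP := E j; rewrite !mxE -d0 mul0r mulf_eq0 (negPf cj) (negPf (a_neq0 j)).
Qed.

(** The weights l_2 and l_5 are eliminated, being determined by the others. *)
Lemma lines_through_rescaleP c j : c 0 = 0 -> c j != 0 ->
  lines_through i gamma a (<[a]> + <[rescale c]>)%VS <->
  exists l1 l3 l4 l6 : k,
    [/\ ~ [/\ l1 = 0, l3 = 0, l4 = 0 & l6 = 0],
        z * y * l1 + (y ^+ 2 - 1) * l3 - i * x * l4 + gamma * y * l6 = 0 &
        [/\ l3 * c 2 = 0, l1 * c 3 = 0,
            l4 * (c 2 - c 1) = 0 & l6 * (c 3 - c 1) = 0]].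
Proof.
move=> c0 cj; have a_neq00 : a != 0.
  by apply: contraNneq (oner_neq0 k) => a00; rewrite -a0 a00 mxE.
apply: iff_trans (lines_throughP gamma i2 (two_neq0 char0) a_neq00 (rescale_notin_line c0 cj)) _.
split=> [[l l0 [al /(rescale_relation c al) cl]] | [l1 [l3 [l4 [l6 [l0 rel cl]]]]]].
  have [l2E l5E rel] := (relation_through_pointP l).1 al.
  exists (l 0 0), (l 0 2), (l 0 3), (l 0 5); split=> //; last by move: cl; rewrite c0 !subr0.
  case=> l00 l02 l03 l05; move/eqP: l0; apply.
  move: l2E l5E; rewrite l00 l02 l03 l05 !mulr0 !addr0 => /eqP + /eqP.
  rewrite !mulf_eq0 (negPf y_neq0) (negPf z_neq0) /= => /eqP l01 /eqP l04.
  apply/rowP => -[[|[|[|[|[|[|//]]]]]] ltj]; rewrite mxE;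
  by [rewrite -[RHS]l00; congr (l _ _); apply: val_inj
     |rewrite -[RHS]l01; congr (l _ _); apply: val_inj
     |rewrite -[RHS]l02; congr (l _ _); apply: val_inj
     |rewrite -[RHS]l03; congr (l _ _); apply: val_inj
     |rewrite -[RHS]l04; congr (l _ _); apply: val_inj
     |rewrite -[RHS]l05; congr (l _ _); apply: val_inj].
pose l : 'rV[k]_6 := \row_j nth 0
  [:: l1; (l3 + i * x * l4) / y; l3; l4; (i * l1 + x * l6) / z; l6] j.
have al : a *m relation_mx i gamma l = 0.
  by apply/relation_through_pointP; rewrite !mxE /= !(mulrC _ (_ / _)) !divfK.
exists l; last by split=> //; apply/(rescale_relation c al); rewrite !mxE /= c0 !subr0.
apply/eqP => /rowP l_0; apply: l0.
by move: (l_0 0) (l_0 2) (l_0 3) (l_0 5); rewrite !mxE /=; split.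
Qed.

(** A point b of the line outside a is moved along the line by a multiple of a
until its first coordinate vanishes. *)
Lemma lines_through_exists_rescale l : lines_through i gamma a l ->
  exists c j, [/\ c 0 = 0, c j != 0 & l = (<[a]> + <[rescale c]>)%VS].
Proof.
case=> /(parametrized_linesP _ i2 (two_neq0 char0)) [dim2 _] al.
have /subvPn [b bl ba] : ~~ (l <= <[a]>)%VS.
  by apply: contraL (isT) => /dimvS; rewrite dim2 dim_vline; case: (a != 0).
pose c j := b 0 j / a 0 j - b 0 0.
have cE : rescale c = b - b 0 0 *: a.
  by apply/rowP => j; rewrite !mxE mulrBl divfK.
have c_l : rescale c \in l by rewrite cE memvB ?memvZ.
have c_a : rescale c \notin <[a]>%VS.
  apply: contraNN ba => ca; rewrite -(subrK (b 0 0 *: a) b) -cE.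
  by rewrite memvD ?memvZ ?memv_line.
have /rV0Pn [j] : rescale c != 0 by apply: contraNneq c_a => ->; rewrite mem0v.
rewrite mxE mulf_eq0 negb_or => /andP [cj _].
exists c, j; split=> //; first by rewrite /c a0 divr1 subrr.
apply/esym/eqP; rewrite eqEdim subv_add -!memvE al c_l dim2 /=.
have : free [:: rescale c; a].
  rewrite free_cons span_seq1 c_a seq1_free.
  by apply: contraNneq (oner_neq0 k) => a00; rewrite -a0 a00 mxE.
by rewrite /free span_cons span_seq1 addvC => /eqP ->.
Qed.

(** The partitions of the four coordinates into two blocks, other than
{1, 2} and {3, 4}; the block of the first coordinate is the one with value
false.  The first four correspond to the lines joining a to e_1, e_2, e_3, e_4. *)
Definition splitting (n : nat) : 'I_4 -> bool :=
  nth false (nth [::] [:: [:: false; true; true; true]; [:: false; true; false; false];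
    [:: false; false; true; false]; [:: false; false; false; true];
    [:: false; true; false; true]; [:: false; true; true; false]] n).

Definition special_line (n : nat) : {vspace 'rV[k]_4} :=
  (<[a]> + <[rescale (fun j => (splitting n j)%:R)]>)%VS.

Lemma splitting_true n : (n < 6)%N -> exists j, splitting n j.
Proof.
by case: n => [|[|[|[|[|[|//]]]]]] _;
  [exists 1 | exists 1 | exists 2 | exists 3 | exists 1 | exists 1].
Qed.

(** Each splitting annihilates two of the four coordinate differences; the two
corresponding weights may be nonzero, and they are the solution of the remaining
two-term linear equation. *)
Lemma special_line_parametrized n : (n < 6)%N ->
  lines_through i gamma a (special_line n).
Proof.
move=> n6; have [j nj] := splitting_true n6.
have cj : (splitting n j)%:R != 0 :> k by rewrite nj oner_neq0.
have c0 : (splitting n 0)%:R = 0 :> k by case: n n6 {nj cj} => [|[|[|[|[|[|//]]]]]].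
apply/(lines_through_rescaleP c0 cj).
have [ix0 zy0 gy0] : [/\ i * x != 0, z * y != 0 & gamma * y != 0].
  by rewrite !mulf_neq0 ?(i_neq0 i2).
case: n n6 {nj cj c0} => [|[|[|[|[|[|//]]]]]] _; rewrite /splitting /=.
- exists 0, 0, (gamma * y), (i * x); split; [by case=> _ _ /eqP + _; apply/negP | by ring |].
  by rewrite subrr !mul0r !mulr0.
- exists (y ^+ 2 - 1), (- (z * y)), 0, 0; split; [by case=> /eqP + _ _ _; apply/negP | by ring |].
  by rewrite !mul0r !mulr0.
- exists gamma, 0, 0, (- z); split; [by case=> /eqP + _ _ _; apply/negP | by ring |].
  by rewrite subrr !mul0r !mulr0.
- exists 0, (i * x), (y ^+ 2 - 1), 0; split; [by case=> _ /eqP + _ _; apply/negP | by ring |].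
  by rewrite subrr !mul0r !mulr0.
- exists 0, (gamma * y), 0, (- (y ^+ 2 - 1)); split; [by case=> _ /eqP + _ _; apply/negP | by ring |].
  by rewrite subrr !mul0r !mulr0.
exists (i * x), 0, (z * y), 0; split; [by case=> /eqP + _ _ _; apply/negP | by ring |].
by rewrite subrr !mul0r !mulr0.
Qed.

(** A point of the line with first coordinate zero is determined up to scaling, and
the 0-1 vectors of the splittings are pairwise non-proportional. *)
Lemma special_line_inj n m : (n < 6)%N -> (m < 6)%N ->
  special_line n = special_line m -> n = m.
Proof.
move=> n6 m6 nm; have [j nj] := splitting_true n6.
have splitting0 r : (r < 6)%N -> splitting r 0 = false.
  by case: r => [|[|[|[|[|[|//]]]]]].
have : rescale (fun j => (splitting n j)%:R) \in special_line m.
  by rewrite -nm memvE addvSr.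
case/memv_addP => _ /vlineP [d ->] [_ /vlineP [e ->] /rowP E].
have d0 : d = 0.
  by have := E 0; rewrite !mxE a0 !splitting0 // mul0r mulr0 addr0 mulr1.
have {}E r : (splitting n r)%:R = e * (splitting m r)%:R.
  by apply: (mulIf (a_neq0 r)); have := E r; rewrite !mxE d0 mul0r add0r mulrA.
have e0 : e != 0.
  by apply: contra_eq_neq (E j) => ->; rewrite nj mul0r oner_neq0.
have {E} same r : splitting n r = splitting m r.
  have /eqP := E r; case: (splitting n r); case: (splitting m r) => //.
    by rewrite mulr0 oner_eq0.
  by rewrite mulr1 eq_sym (negPf e0).
have := (same 1, same 2, same 3).
by case: n n6 {nm nj same} => [|[|[|[|[|[|//]]]]]] _;
   case: m m6 => [|[|[|[|[|[|//]]]]]] _; rewrite /splitting /= => -[[]].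
Qed.

(** At least two of l_1, l_3, l_4, l_6 are nonzero; each choice of two forces two
equalities among 0, c_2, c_3, c_4, hence one of the splittings up to a scalar. *)
Lemma lines_through_special l : lines_through i gamma a l ->
  exists2 n, (n < 6)%N & l = special_line n.
Proof.
move=> la; have [c [j [c0 cj lE]]] := lines_through_exists_rescale la.
suff [n n6 [d cE]] : exists2 n, (n < 6)%N & exists d, forall r, c r = d * (splitting n r)%:R.
  exists n => //; apply/eqP; rewrite eqEdim.
  have dim2 l' : lines_through i gamma a l' -> \dim l' = 2%N.
    by case=> /(parametrized_linesP _ i2 (two_neq0 char0)) [].
  rewrite !dim2 // ?leqnn ?andbT; last exact: special_line_parametrized.
  rewrite lE subv_add addvSl -memvE /=.
  have -> : rescale c = d *: rescale (fun r => (splitting n r)%:R).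
    by apply/rowP => r; rewrite !mxE cE mulrA.
  by rewrite memvZ // memvE addvSr.
move: la; rewrite lE => /(lines_through_rescaleP c0 cj).
case=> l1 [l3 [l4 [l6 [l0 rel [E3 E1 E4 E6]]]]].
have cancel (t w : k) : t != 0 -> t * w = 0 -> w = 0.
  by move=> t0 /eqP; rewrite mulf_eq0 (negPf t0) => /eqP.
have two_eq (t : k) (u w : k) : t != 0 -> t * (u - w) = 0 -> u = w.
  by move=> t0 /(cancel _ _ t0) /eqP; rewrite subr_eq0 => /eqP.
have found n d : (n < 6)%N -> c 1 = d * (splitting n 1)%:R ->
    c 2 = d * (splitting n 2)%:R -> c 3 = d * (splitting n 3)%:R ->
    exists2 n, (n < 6)%N & exists d, forall r, c r = d * (splitting n r)%:R.
  move=> n6 c1 c2 c3; exists n => //; exists d; elim/I4_ind => //; rewrite c0.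
  by case: n n6 {c1 c2 c3} => [|[|[|[|[|[|//]]]]]] _; rewrite mulr0.
have [l1_0 | l1_neq0] := eqVneq l1 0; last first.
  have c3 := cancel _ _ l1_neq0 E1.
  have [l3_0 | l3_neq0] := eqVneq l3 0; last first.
    by apply: (found 1%N (c 1)) => //=; rewrite ?mulr1 ?mulr0 ?c3 // (cancel _ _ l3_neq0 E3).
  have [l4_0 | l4_neq0] := eqVneq l4 0; last first.
    by apply: (found 5 (c 1)) => //=; rewrite ?mulr1 ?mulr0 ?c3 // (two_eq _ _ _ l4_neq0 E4).
  have [l6_0 | l6_neq0] := eqVneq l6 0; last first.
    by apply: (found 2 (c 2)) => //=; rewrite ?mulr1 ?mulr0 ?c3 // -(two_eq _ _ _ l6_neq0 E6).
  move/eqP: rel; rewrite l3_0 l4_0 l6_0 !mulr0 !addr0 subr0.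
  by rewrite !mulf_eq0 (negPf y_neq0) (negPf z_neq0) (negPf l1_neq0).
have [l3_0 | l3_neq0] := eqVneq l3 0; last first.
  have c2 := cancel _ _ l3_neq0 E3.
  have [l4_0 | l4_neq0] := eqVneq l4 0; last first.
    by apply: (found 3 (c 3)) => //=; rewrite ?mulr1 ?mulr0 ?c2 // -(two_eq _ _ _ l4_neq0 E4).
  have [l6_0 | l6_neq0] := eqVneq l6 0; last first.
    by apply: (found 4 (c 1)) => //=; rewrite ?mulr1 ?mulr0 ?c2 // (two_eq _ _ _ l6_neq0 E6).
  move/eqP: rel; rewrite l1_0 l4_0 l6_0 !mulr0 add0r addr0 subr0.
  by rewrite mulf_eq0 (negPf y2m1_neq0) (negPf l3_neq0).
have [l4_0 | l4_neq0] := eqVneq l4 0; have [l6_0 | l6_neq0] := eqVneq l6 0.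
- by case: l0.
- move/eqP: rel; rewrite l1_0 l3_0 l4_0 !mulr0 subr0 !add0r.
  by rewrite !mulf_eq0 (negPf gamma0) (negPf y_neq0) (negPf l6_neq0).
- move/eqP: rel; rewrite l1_0 l3_0 l6_0 !mulr0 addr0 !add0r oppr_eq0.
  by rewrite !mulf_eq0 (negPf (i_neq0 i2)) (negPf x_neq0) (negPf l4_neq0).
by apply: (found 0%N (c 1)) => //=; rewrite mulr1 // ?(two_eq _ _ _ l4_neq0 E4)
  ?(two_eq _ _ _ l6_neq0 E6).
Qed.

Lemma card_lines_through_point : (lines_through i gamma a #= `I_6)%card.
Proof.
have -> : lines_through i gamma a = (special_line @` `I_6)%classic.
  apply/seteqP; split=> [l /lines_through_special [n n6 ->] | _ [n n6 <-]].
    by exists n.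
  exact: special_line_parametrized.
apply: inj_card_eq => n m; rewrite !inE; exact: special_line_inj.
Qed.

End PointOfZgamma.

Theorem theorem4p1 (k : closedFieldType) (char0 : [pchar k] =i pred0)
    (i gamma : k) (i2 : i ^+ 2 = -1) (gamma0 : gamma != 0) :
  (forall j : 'I_4, infinite_set (lines_through i gamma (delta_mx 0 j))) /\
  (forall a : 'rV[k]_4, Zgamma i gamma a ->
     (lines_through i gamma a #= `I_6)%card).
Proof.
split=> [j | a aZ]; first exact: infinite_lines_through_vertex.
exact: card_lines_through_point.
Qed.
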